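(* Let $\mathcal H$ be a hypergraph on a finite set $V$ with $\operatorname{rank}(\mathcal H)\le2$. Let $D_1,\dots,D_t$ be the connected components of $G_{\mathcal H}$, let $F$ be the union of the forced components, and let $C_1,\dots,C_q$ be the remaining (unforced) components. For every $Y\subseteq V$, $$\operatorname{cl}_{\mathcal H}(Y)=F\cup\bigcup_{D_i\cap Y\neq\varnothing}D_i.$$ Consequently, the closed sets are precisely the sets $F\cup\bigcup_{i\in I}C_i$, where $I\subseteq\{1,\dots,q\}$, and the stopping sets are precisely the unions of unforced components. If $q=0$, then $V$ is the only closed set and there is no coatom. If $q>0$, then $$\mathcal M(\Phi_{\mathcal H})=\{V\setminus C_i: 1\le i\le q\},\qquad \operatorname{MinStop}(\mathcal H)=\{C_i:1\le i\le q\}.$$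
   Context: A hypergraph on a finite set $V$ is a family $\mathcal H\subseteq 2^V$; $\operatorname{rank}(\mathcal H)=\max_{A\in\mathcal H}|A|$ (zero if $\mathcal H$ is empty). The associated definite Horn CNF is $\Phi_{\mathcal H}=\bigwedge_{A\in\mathcal H}\bigwedge_{v\in A}((A\setminus\{v\})\to v)$, with model family $\operatorname{Mod}(\Phi_{\mathcal H})\subseteq2^V$ (models identified with sets of true variables); its members are called closed sets, and $\operatorname{cl}_{\mathcal H}(Y)=\bigcap\{M\in\operatorname{Mod}(\Phi_{\mathcal H}):Y\subseteq M\}$. $\mathcal M(\Phi_{\mathcal H})$ is the family of coatoms, i.e. the inclusion-maximal members of $\operatorname{Mod}(\Phi_{\mathcal H})\setminus\{V\}$. A stopping set is a set $S\subseteq V$ with $|A\cap S|\neq1$ for every $A\in\mathcal H$, and $\operatorname{MinStop}(\mathcal H)$ is the family of inclusion-minimal nonempty stopping sets. For $\operatorname{rank}(\mathcal H)\le2$, $G_{\mathcal H}$ is the graph on $V$ whose edges are the two-element hyperedges of $\mathcal H$; its connected components include isolated vertices. A component is forced if it contains a vertex $v$ with $\{v\}\in\mathcal H$. *)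

(* Defs.v *)
From mathcomp Require Export all_boot.

Set Implicit Arguments.
Unset Strict Implicit.
Unset Printing Implicit Defensive.

Section Hypergraph.
Variable V : finType.
Implicit Types (H : {set {set V}}) (Y S : {set V}).

Definition hrank H : nat := \max_(A in H) #|A|.

(* The pair (B, v) is the definite Horn clause whose body is the conjunction
   of the variables in B and whose head is v; a set of clauses is read as the
   conjunction of its members, and a set of variables M as the assignment
   making exactly the variables in M true. *)
Definition horn_clause : finType := ({set V} * V)%type.

Definition satisfies (M : {set V}) (c : horn_clause) : bool :=
  (c.1 \subset M) ==> (c.2 \in M).

Definition Mod (Phi : {set horn_clause}) : {set {set V}} :=
  [set M : {set V} | [forall c in Phi, satisfies M c]].

Definition coatoms (Phi : {set horn_clause}) : {set {set V}} :=
  [set M | maxset [in Mod Phi :\ [set: V]] M].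

Definition Phi_of H : {set horn_clause} :=
  [set ((A :\ v, v) : horn_clause) | A in H, v in A].

Definition cl H Y : {set V} := \bigcap_(M in Mod (Phi_of H) | Y \subset M) M.

Definition stopping H : pred {set V} :=
  fun S => [forall A in H, #|A :&: S| != 1].

Definition MinStop H : {set {set V}} :=
  [set S | minset (fun S' => (S' != set0) && stopping H S') S].

Definition edge H : rel V := fun u v => (u != v) && ([set u; v] \in H).

Definition components H : {set {set V}} :=
  equivalence_partition (connect (edge H)) [set: V].

Definition forced H : pred {set V} := fun D => [exists v in D, [set v] \in H].

Definition forced_components H : {set {set V}} :=
  [set D in components H | forced H D].

Definition unforced_components H : {set {set V}} :=
  [set D in components H | ~~ forced H D].

End Hypergraph.

(* Main.v *)
Require Import Defs.
From mathcomp Require Import all_boot.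

(** Some clause of a hyperedge A fails at M exactly when all but one of the
    vertices of A lie in M, so closed sets are the complements of stopping sets
    ([Mod_stopping]), for hypergraphs of any rank.  In rank at most 2 the
    stopping condition for S is local: a hyperedge {v} forbids v in S, and a
    hyperedge {u, v} forbids S from separating u and v ([stopping_rank2P]).
    Hence S is stopping iff it is a union of connected components none of which
    contains a forbidden vertex, i.e. a union of unforced components
    ([stopping_unionP]).

    The rest is about the partition of V into components.  A union of blocks is
    a set of blocks, and complementing the union complements the set of blocks
    ([setC_cover]); so closed sets are F together with arbitrary unforced
    components.  The closure of Y is then read off as the least such set
    containing Y, minimal nonempty unions of unforced components are the
    unforced components themselves ([MinStop_unforced]), and coatoms are the
    complements of the minimal nonempty stopping sets ([coatoms_MinStop]). *)

(** * Unions of blocks of a partition *)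

Section Blocks.
Variables (T : finType) (P : {set {set T}}).
Hypothesis partP : partition P [set: T].
Implicit Types (I : {set {set T}}) (B : {set T}).

(** Blocks are disjoint, so membership in a union of blocks only depends on
    the block of the point. *)
Lemma mem_cover_blocks I x : I \subset P -> (x \in cover I) = (pblock P x \in I).
Proof.
move=> sIP; have /and3P[/eqP coverP triv _] := partP.
apply/bigcupP/idP => [[B BI Bx]|]; last first.
  by exists (pblock P x) => //; rewrite mem_pblock coverP inE.
by rewrite (def_pblock triv (subsetP sIP _ BI) Bx).
Qed.

Lemma pblock_in x : pblock P x \in P.
Proof.
by apply: pblock_mem; have /and3P[/eqP-> _ _] := partP; rewrite inE.
Qed.

Lemma mem_pblockT x : x \in pblock P x.
Proof. by rewrite mem_pblock; have /and3P[/eqP-> _ _] := partP; rewrite inE. Qed.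

Lemma setC_cover I : I \subset P -> ~: cover I = cover (P :\: I).
Proof.
move=> sIP; apply/setP=> x.
by rewrite inE !mem_cover_blocks ?subsetDl // inE pblock_in andbT.
Qed.

End Blocks.

Section Hypergraph.
Variables (V : finType) (H : {set {set V}}).
Implicit Types (S M Y D : {set V}) (I : {set {set V}}).

(** * Closed sets and stopping sets *)

(** A violated clause (A minus v) -> v at M says precisely that v is the only
    vertex of A outside M. *)
Lemma Mod_stopping M : (M \in Mod (Phi_of H)) = stopping H (~: M).
Proof.
rewrite inE; apply/forall_inP/forall_inP => [modM A AH | stopM c].
  apply/negP => /cards1P[v defv].
  have : v \in A :&: ~: M by rewrite defv set11.
  rewrite !inE => /andP[Av /negP[]].
  have /implyP := modM (A :\ v, v) (imset2_f _ AH Av); apply => /=.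
  rewrite subDset; apply/subsetP=> w Aw; rewrite inE orbC.
  by case Mw: (w \in M) => //=; rewrite -defv !inE Aw Mw.
case/imset2P=> A v AH Av ->; apply/implyP => /= sAM.
apply: contraR (stopM A AH) => Mv; apply/cards1P; exists v.
apply/setP=> w; rewrite !inE; apply/andP/eqP => [[Aw Mw]|->] //.
by apply: contraNeq Mw => neq_wv; apply: (subsetP sAM); rewrite !inE neq_wv.
Qed.

Lemma stopping0 : stopping H set0.
Proof. by apply/forall_inP => A _; rewrite setI0 cards0. Qed.

(** Complementation reverses inclusion and sends closed sets other than V to
    nonempty stopping sets. *)
Lemma coatoms_MinStop : coatoms (Phi_of H) = [set ~: S | S in MinStop H].
Proof.
have properMod M : (M \in Mod (Phi_of H) :\ [set: V]) =
    (~: M != set0) && stopping H (~: M).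
  by rewrite in_setD1 Mod_stopping -setCT (inj_eq (@setC_inj V)).
apply/setP=> M; rewrite -[M in RHS]setCK (mem_imset _ _ (@setC_inj V)) !inE.
apply/maxsetP/minsetP; rewrite properMod => -[stopM extrM]; split=> // S stopS sSM.
  by rewrite -(extrM (~: S)) ?setCK ?properMod ?setCK // -setCS setCK.
by apply: setC_inj; apply: extrM; rewrite ?setCS // -properMod.
Qed.

(** * Components *)

Lemma edge_sym : symmetric (edge H).
Proof. by move=> u v; rewrite /edge eq_sym setUC. Qed.

Lemma connect_equiv : {in [set: V] & &, equivalence_rel (connect (edge H))}.
Proof.
move=> x y z _ _ _; split=> [|xy]; first exact: connect0.
exact: (same_connect (sym_connect_sym edge_sym) xy).
Qed.

Lemma components_partition : partition (components H) [set: V].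
Proof. exact: equivalence_partitionP connect_equiv. Qed.

Local Notation comp := (pblock (components H)).

Lemma mem_component u v : (v \in comp u) = connect (edge H) u v.
Proof.
by rewrite (pblock_equivalence_partition connect_equiv) ?inE.
Qed.

Lemma unforced_sub : unforced_components H \subset components H.
Proof. by apply/subsetP=> D; rewrite inE => /andP[]. Qed.

Lemma forced_setD :
  components H :\: unforced_components H = forced_components H.
Proof.
by apply/setP=> D; rewrite !inE; case: (D \in _); rewrite ?andbF ?andbT ?negbK.
Qed.

(** * Stopping sets in rank at most 2 *)

Hypothesis rankH : hrank H <= 2.

(** If A meets S in u only, the at most one other vertex of A decides the case:
    either A is an edge leaving S at u, or A = {u} with u in S. *)
Lemma stopping_rank2P S :
  reflect ((forall v, [set v] \in H -> v \notin S) /\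
           (forall u v, edge H u v -> u \in S -> v \in S))
          (stopping H S).
Proof.
apply: (iffP forall_inP) => [stopS | [noloop closedS] A AH].
  split=> [v vH | u v /andP[_ uvH] uS].
    apply: contraNN (stopS _ vH) => vS.
    by rewrite (setIidPl _) ?cards1 // sub1set.
  apply: contraR (stopS _ uvH) => vS; apply/cards1P; exists u.
  apply/setP=> w; rewrite !inE.
  case: (eqVneq w u) => [->|_] /=; first by rewrite uS.
  by case: eqP => // ->; rewrite (negPf vS).
apply/negP => /cards1P[u defu].
have : u \in A :&: S by rewrite defu set11.
rewrite inE => /andP[uA uS].
have /bigmax_leqP/(_ A AH) := rankH.
rewrite (cardsD1 u) uA ltnS leq_eqVlt ltnS leqn0 cards_eq0.
case/orP=> [/cards1P[v defv] | /eqP defA].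
  have /setD1P[neq_vu vA] : v \in A :\ u by rewrite defv set11.
  have Euv : edge H u v by rewrite /edge eq_sym neq_vu -defv setD1K.
  have: v \in A :&: S by rewrite inE vA (closedS u).
  by rewrite defu inE (negPf neq_vu).
have /noloop/negP[] // : [set u] \in H.
by rewrite -(setU0 [set u]) -defA setD1K.
Qed.

(** Closure under edges propagates along paths, so a stopping set contains the
    component of each of its points; that component is unforced because no
    vertex v with {v} a hyperedge lies in the set. *)
Lemma stopping_unionP S :
  stopping H S <->
    exists2 I : {set {set V}}, I \subset unforced_components H & S = \bigcup_(C in I) C.
Proof.
have partH := components_partition.
split=> [/stopping_rank2P[noloop closedS] | [I sIU ->]].
  have compS x : x \in S -> comp x \subset S.
    move=> xS; apply/subsetP=> y; rewrite mem_component => /connectP[p].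
    elim: p x xS => [|z p IHp] x xS /= => [_ -> //|/andP[xz zp]].
    exact: IHp (closedS _ _ xz xS) zp.
  exists [set D in unforced_components H | D \subset S].
    by apply/subsetP=> D; rewrite inE => /andP[].
  apply/setP=> x; apply/idP/bigcupP => [xS | [D]]; last first.
    by rewrite inE => /andP[_ /subsetP]; apply.
  exists (comp x); last exact: mem_pblockT.
  rewrite !inE pblock_in // compS // andbT /=.
  apply/exists_inP => -[v vx vH].
  by case/negP: (noloop v vH); apply: (subsetP (compS x xS)).
have sIH := subset_trans sIU unforced_sub.
rewrite -/(cover I); apply/stopping_rank2P; split=> [v vH | u v Euv].
  rewrite (mem_cover_blocks _ _ partH) //; apply/negP => /(subsetP sIU).
  by rewrite inE => /andP[_ /exists_inP[]]; exists v; rewrite ?mem_pblockT.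
rewrite !(mem_cover_blocks _ _ partH) // (_ : comp u = comp v) //.
have /and3P[_ triv _] := partH.
apply/esym/def_pblock => //; first exact: pblock_in.
by rewrite mem_component connect1.
Qed.

(** * The closed sets, the closure and the extremal sets *)

(** A closed set consists of the components missing from its complementary
    stopping set, which uses unforced ones only; hence the forced components always occur. *)
Lemma Mod_unionP M :
  M \in Mod (Phi_of H) <->
    exists2 I : {set {set V}}, I \subset unforced_components H &
      M = \bigcup_(D in forced_components H) D :|: \bigcup_(C in I) C.
Proof.
have partH := components_partition.
have compl I : I \subset unforced_components H ->
    ~: cover I = cover (forced_components H) :|: cover (unforced_components H :\: I).
  move=> sIU; rewrite (setC_cover _ _ partH) ?(subset_trans sIU unforced_sub) //.
  rewrite -forced_setD /cover -bigcup_setU.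
  apply: eq_bigl => D; rewrite !inE.
  have := subsetP sIU D; rewrite inE.
  case: (D \in I) => [/(_ isT)/andP[-> ->]|_] //.
  by case: (D \in _); case: (forced _ _).
rewrite Mod_stopping; split=> [/stopping_unionP[I sIU defM] | [I sIU ->]].
  exists (unforced_components H :\: I); first exact: subsetDl.
  by rewrite -[LHS]setCK defM compl.
apply/stopping_unionP; exists (unforced_components H :\: I).
  exact: subsetDl.
apply: setC_inj; rewrite setCK [RHS]compl ?subsetDl //.
by rewrite setDDr setDv set0U (setIidPr sIU).
Qed.

(** The right-hand side is a closed set containing Y; conversely a closed set
    containing Y is a union of components, and so contains every component
    that meets Y. *)
Lemma cl_components Y :
  cl H Y = \bigcup_(D in forced_components H) D
           :|: \bigcup_(D in components H | D :&: Y != set0) D.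
Proof.
have partH := components_partition; have /and3P[_ triv _] := partH.
set F := \bigcup_(D in forced_components H) D; set U := \bigcup_(D in _ | _) D.
have modFU : F :|: U \in Mod (Phi_of H).
  apply/Mod_unionP.
  exists [set D in unforced_components H | D :&: Y != set0].
    by apply/subsetP=> D; rewrite inE => /andP[].
  apply/setP=> x; rewrite !in_setU; case Fx: (x \in F) => //=.
  apply/bigcupP/bigcupP => -[D]; rewrite ?inE.
    case/andP=> DH DY Dx; exists D => //; rewrite !inE DH DY andbT /=.
    apply: contraFN Fx => fD; apply/bigcupP; exists D => //.
    by rewrite inE DH.
  by case/andP=> /andP[DH _] DY Dx; exists D => //; rewrite DH.
have sYFU : Y \subset F :|: U.
  apply/subsetP=> y Yy; rewrite inE; apply/orP; right; apply/bigcupP.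
  exists (comp y); last exact: mem_pblockT.
  by rewrite pblock_in //; apply/set0Pn; exists y; rewrite inE mem_pblockT.
apply/eqP; rewrite eqEsubset; apply/andP; split.
  by apply: bigcap_inf; rewrite modFU.
apply/bigcapsP=> M /andP[/Mod_unionP[I sIU ->] sYM].
rewrite subUset subsetUl /=; apply/bigcupsP=> D /andP[DH /set0Pn[y]].
rewrite inE => /andP[Dy /(subsetP sYM)].
rewrite inE => /orP[] /bigcupP[C CI Cy]; last first.
  have CH := subsetP unforced_sub _ (subsetP sIU _ CI).
  rewrite -(def_pblock triv DH Dy) (def_pblock triv CH Cy).
  exact/subsetU/orP/or_intror/(bigcup_sup C).
have CH : C \in components H by move: CI; rewrite inE => /andP[].
rewrite -(def_pblock triv DH Dy) (def_pblock triv CH Cy).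
exact/subsetU/orP/or_introl/(bigcup_sup C).
Qed.

(** A nonempty union of unforced components contains one of them, and an
    unforced component contains no other. *)
Lemma MinStop_unforced : MinStop H = unforced_components H.
Proof.
have partH := components_partition; have /and3P[_ triv set0H] := partH.
have unforced_stop C : C \in unforced_components H -> (C != set0) && stopping H C.
  move=> CU; apply/andP; split.
    apply: contraNneq set0H => <-; exact: (subsetP unforced_sub).
  by apply/stopping_unionP; exists [set C]; rewrite ?sub1set ?big_set1.
have unforced_below S : (S != set0) && stopping H S ->
    exists2 C, C \in unforced_components H & C \subset S.
  case/andP=> /set0Pn[x Sx] /stopping_unionP[I sIU defS].
  have /bigcupP[C CI _] : x \in \bigcup_(C in I) C by rewrite -defS.
  by exists C; [apply: (subsetP sIU) | rewrite defS (bigcup_sup C)].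
apply/setP=> S; rewrite [LHS]inE; apply/minsetP/idP => [[stopS minS] | SU].
  have [C CU sCS] := unforced_below S stopS.
  by rewrite -(minS C) ?unforced_stop.
split=> [|S' stopS' sS'S]; first exact: unforced_stop.
have [C CU sCS'] := unforced_below S' stopS'.
have [/set0Pn[x Cx] _] := andP (unforced_stop C CU).
have defC : C = S.
  have Sx : x \in S by rewrite (subsetP sS'S) // (subsetP sCS').
  rewrite -(def_pblock triv (subsetP unforced_sub _ CU) Cx).
  by rewrite (def_pblock triv (subsetP unforced_sub _ SU) Sx).
by apply/eqP; rewrite eqEsubset sS'S -defC sCS'.
Qed.

End Hypergraph.

Theorem proposition5p1 (V : finType) (H : {set {set V}}) (rankH : hrank H <= 2) :
  let F := \bigcup_(D in forced_components H) D in
  let q := #|unforced_components H| in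
  [/\ forall Y : {set V},
        cl H Y = F :|: \bigcup_(D in components H | D :&: Y != set0) D,
      forall M : {set V}, M \in Mod (Phi_of H) <->
        exists2 I : {set {set V}}, I \subset unforced_components H &
          M = F :|: \bigcup_(C in I) C,
      forall S : {set V}, stopping H S <->
        exists2 I : {set {set V}}, I \subset unforced_components H &
          S = \bigcup_(C in I) C,
      q = 0 ->
        Mod (Phi_of H) = [set [set: V]] /\ coatoms (Phi_of H) = set0
    & 0 < q ->
        coatoms (Phi_of H) = [set ~: C | C in unforced_components H] /\
        MinStop H = unforced_components H].
Proof.
move=> F q; split=> [Y | M | S | /eqP | _].
- exact: cl_components.
- exact: Mod_unionP.
- exact: stopping_unionP.
- rewrite cards_eq0 => /eqP U0; split; last first.
    by rewrite coatoms_MinStop MinStop_unforced // U0 imset0.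
  apply/setP=> M; rewrite Mod_stopping inE -(inj_eq (@setC_inj V)) setCT.
  apply/idP/eqP => [/(stopping_unionP _ _ rankH)[I] | ->]; last exact: stopping0.
  by rewrite U0 subset0 => /eqP-> ->; rewrite big_set0.
- by rewrite coatoms_MinStop MinStop_unforced.
Qed.
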